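(* Let $\alpha,\beta,\gamma\in\mathbb{C}$ and $x,y\in\mathbb{C}$ with $|x|<1$, $|y|<1$. (i) Suppose $q^\gamma\notin\{1,q^{-1},q^{-2},\dots\}$, and, in the identities involving $q^{\gamma-1}$ as denominator parameter, also $q^\gamma\ne q$. Then, with $\mathbf{\Phi}_i=\mathbf{\Phi}_i(q^\alpha,q^\beta;q^\gamma;q,x,y)$ for $i=1,2$, $$[\mathbf{\Theta}_{x,q}+\mathbf{\Theta}_{y,q}+\alpha]_{q}\mathbf{\Phi}_{1}=[\alpha]_{q}\mathbf{\Phi}_{1}(q^{\alpha+1},q^\beta;q^\gamma;q,x,y),$$ $$[\mathbf{\Theta}_{x,q}+\beta]_{q}\mathbf{\Phi}_{1}=[\beta]_{q}\mathbf{\Phi}_{1}(q^\alpha,q^{\beta+1};q^\gamma;q,x,y),$$ $$[\mathbf{\Theta}_{x,q}+\mathbf{\Theta}_{y,q}+\gamma-1]_{q}\mathbf{\Phi}_{1}=[\gamma-1]_{q}\mathbf{\Phi}_{1}(q^\alpha,q^\beta;q^{\gamma-1};q,x,y),$$ $$[\mathbf{\Theta}_{x,q}+\alpha]_{q}\mathbf{\Phi}_{2}=[\alpha]_{q}\mathbf{\Phi}_{2}(q^{\alpha+1},q^\beta;q^\gamma;q,x,y),$$ $$[\mathbf{\Theta}_{y,q}+\beta]_{q}\mathbf{\Phi}_{2}=[\beta]_{q}\mathbf{\Phi}_{2}(q^\alpha,q^{\beta+1};q^\gamma;q,x,y),$$ $$[\mathbf{\Theta}_{x,q}+\mathbf{\Theta}_{y,q}+\gamma-1]_{q}\mathbf{\Phi}_{2}=[\gamma-1]_{q}\mathbf{\Phi}_{2}(q^\alpha,q^\beta;q^{\gamma-1};q,x,y).$$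 (ii) Suppose $q^\beta\notin\{1,q^{-1},q^{-2},\dots\}$, and, in the second identity, also $q^\beta\neq q$. Then, with $\mathbf{\Phi}_3=\mathbf{\Phi}_3(q^\alpha;q^\beta;q,x,y)$, $$[\mathbf{\Theta}_{x,q}+\alpha]_{q}\mathbf{\Phi}_{3}=[\alpha]_{q}\mathbf{\Phi}_{3}(q^{\alpha+1};q^\beta;q,x,y),$$ $$[\mathbf{\Theta}_{x,q}+\mathbf{\Theta}_{y,q}+\beta-1]_{q}\mathbf{\Phi}_{3}=[\beta-1]_{q}\mathbf{\Phi}_{3}(q^\alpha;q^{\beta-1};q,x,y).$$
   Context: Fix $q\in\mathbb{C}$ with $0<|q|<1$ and a choice of $\log q$, so that $q^{z}=e^{z\log q}$ for $z\in\mathbb{C}$. Put $[z]_q=\frac{1-q^z}{1-q}$. The $q$-shifted factorial is $(a;q)_0=1$, $(a;q)_\ell=\prod_{j=0}^{\ell-1}(1-aq^j)$ for $\ell\ge 1$. The basic Humbert functions are, for $|x|<1,|y|<1$, $$\mathbf{\Phi}_{1}(q^{\alpha},q^{\beta};q^{\gamma};q,x,y)=\sum_{n,k=0}^{\infty}\frac{(q^{\alpha};q)_{n+k}(q^{\beta};q)_{n}}{(q^{\gamma};q)_{n+k}(q;q)_{n}(q;q)_{k}}x^{n}y^{k},$$ $$\mathbf{\Phi}_{2}(q^{\alpha},q^{\beta};q^{\gamma};q,x,y)=\sum_{n,k=0}^{\infty}\frac{(q^{\alpha};q)_{n}(q^{\beta};q)_{k}}{(q^{\gamma};q)_{n+k}(q;q)_{n}(q;q)_{k}}x^{n}y^{k},$$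 $$\mathbf{\Phi}_{3}(q^{\alpha};q^{\beta};q,x,y)=\sum_{n,k=0}^{\infty}\frac{(q^{\alpha};q)_{n}}{(q^{\beta};q)_{n+k}(q;q)_{n}(q;q)_{k}}x^{n}y^{k},$$ defined when the denominator parameter ($q^\gamma$ for $\mathbf\Phi_1,\mathbf\Phi_2$; $q^\beta$ for $\mathbf\Phi_3$) is not in $\{1,q^{-1},q^{-2},\dots\}$. The operators $q^{\mathbf{\Theta}_{x,q}}$ and $q^{\mathbf{\Theta}_{y,q}}$ are by convention the dilations $f(x,y)\mapsto f(qx,y)$ and $f(x,y)\mapsto f(x,qy)$. For $c\in\mathbb{C}$, $a,b\in\{0,1\}$, the operator $[a\mathbf{\Theta}_{x,q}+b\mathbf{\Theta}_{y,q}+c]_q$ is $\frac{1}{1-q}\big(1-q^{c}(q^{\mathbf{\Theta}_{x,q}})^{a}(q^{\mathbf{\Theta}_{y,q}})^{b}\big)$, i.e. $f(x,y)\mapsto\frac{f(x,y)-q^cf(q^ax,q^by)}{1-q}$; it multiplies $x^ny^k$ by $[an+bk+c]_q$. *)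

(* Defs.v *)
From HB Require Import structures.
From mathcomp Require Import all_boot all_order all_algebra.
From mathcomp Require Import complex.
From mathcomp Require Import all_classical all_reals all_analysis.
From mathcomp Require summability.
Set Implicit Arguments.
Unset Strict Implicit.
Unset Printing Implicit Defensive.
Import Order.TTheory GRing.Theory Num.Theory.
Import numFieldNormedType.Exports.
Local Open Scope ring_scope.
Local Open Scope complex_scope.

(* The sum of the family [u n k] over all pairs [(n, k)], i.e. the limit of its
   finite partial sums along the finite subsets of [nat * nat] directed by
   inclusion, for the topology of the modulus on [R[i]]. The ascription to
   [numFieldType] is what selects the normed module structure. *)
Definition dsum (R : realType) (u : nat -> nat -> R[i]) : R[i] :=
  @summability.sum (nat * nat)%type R[i] (R[i] : numFieldType)
    (fun nk => u nk.1 nk.2).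

Definition cexp (R : realType) (z : R[i]) : R[i] :=
  let: s +i* t := z in (expR s * cos t) +i* (expR s * sin t).

(* The power [q ^ z] attached to the choice [lq] of a logarithm of [q]. *)
Definition qpow (R : realType) (lq z : R[i]) : R[i] := cexp (z * lq).

Definition qnum (R : realType) (q lq z : R[i]) : R[i] :=
  (1 - qpow lq z) / (1 - q).

Definition qfact (R : realType) (q a : R[i]) (l : nat) : R[i] :=
  \prod_(j < l) (1 - a * q ^+ j).

(* [c] is an admissible denominator parameter: [c] is none of
   [1, q^-1, q^-2, ...]. *)
Definition qdenom (R : realType) (q c : R[i]) : Prop :=
  forall m : nat, c != q ^- m.

(* In the three basic Humbert functions, [a], [b], [c] stand for the values of
   the parameters [q ^ alpha], [q ^ beta], [q ^ gamma] (and, in [Phi3], [b] for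
   the denominator parameter [q ^ beta]), not for the exponents. *)
Definition Phi1 (R : realType) (q a b c x y : R[i]) : R[i] :=
  dsum (fun n k =>
    qfact q a (n + k)%N * qfact q b n
      / (qfact q c (n + k)%N * qfact q q n * qfact q q k) * x ^+ n * y ^+ k).

Definition Phi2 (R : realType) (q a b c x y : R[i]) : R[i] :=
  dsum (fun n k =>
    qfact q a n * qfact q b k
      / (qfact q c (n + k)%N * qfact q q n * qfact q q k) * x ^+ n * y ^+ k).

Definition Phi3 (R : realType) (q a b x y : R[i]) : R[i] :=
  dsum (fun n k =>
    qfact q a n
      / (qfact q b (n + k)%N * qfact q q n * qfact q q k) * x ^+ n * y ^+ k).

Definition dilx (R : realType) (q : R[i]) (f : R[i] -> R[i] -> R[i]) :
  R[i] -> R[i] -> R[i] := fun x y => f (q * x) y.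

Definition dily (R : realType) (q : R[i]) (f : R[i] -> R[i] -> R[i]) :
  R[i] -> R[i] -> R[i] := fun x y => f x (q * y).

(* [qTheta q lq a b c] is the operator [a Theta_x + b Theta_y + c]_q. *)
Definition qTheta (R : realType) (q lq : R[i]) (a b : nat) (c : R[i])
    (f : R[i] -> R[i] -> R[i]) : R[i] -> R[i] -> R[i] :=
  fun x y =>
    (f x y - qpow lq c * iter a (dilx q) (iter b (dily q) f) x y) / (1 - q).

(* Main.v *)
(* The factors (a;q)_l and 1/(c;q)_l are bounded in l: each is a product of
   factors of modulus at most 1 + K|q|^j, hence at most exp(K/(1-|q|)). So all
   the coefficients are bounded and the double series converge absolutely for
   |x|, |y| < 1. The operator [a Theta_x + b Theta_y + z]_q then acts
   termwise, multiplying x^n y^k by [an + bk + z]_q, and each identity reduces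
   to (1 - a q^l) (a;q)_l = (1 - a) (aq;q)_l, applied with a = q^alpha,
   q^beta, or (for the denominators) q^(gamma-1). *)
Require Import Defs.
From mathcomp Require Import all_boot all_order all_algebra.
From mathcomp Require Import complex finmap.
From mathcomp Require Import all_classical all_reals all_analysis.
From mathcomp Require Import ring lra.
From mathcomp Require summability.
Import Order.TTheory GRing.Theory Num.Theory.
Import numFieldNormedType.Exports.
Local Open Scope ring_scope.
Local Open Scope complex_scope.

Set Implicit Arguments.
Unset Strict Implicit.
Unset Printing Implicit Defensive.

Import Normc.
#[local] Existing Instance summability.totally_filter.

(** * Unconditional summation of real and complex families over finite subsets *)

Section Summation.
Variable R : realType.
Local Notation C := (R[i] : numFieldType).

Lemma ler_sum_sub (I : eqType) (s t : seq I) (F : I -> R) :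
  uniq s -> uniq t -> {subset s <= t} -> (forall i, 0 <= F i) ->
  \sum_(i <- s) F i <= \sum_(i <- t) F i.
Proof.
move=> us ut sub F0.
have st : perm_eq s [seq i <- t | i \in s].
  apply: uniq_perm => //; first exact: filter_uniq.
  by move=> i; rewrite mem_filter; case: (boolP (i \in s)) => // /sub ->.
by rewrite (perm_big _ st) big_filter [leRHS](bigID (mem s)) /= lerDl sumr_ge0.
Qed.

Lemma partial_sumE (I : choiceType) (V : zmodType) (f : I -> V) A :
  summability.partial_sum f A = \sum_(i <- A) f i.
Proof. by rewrite /summability.partial_sum big_seq_fsetE. Qed.

(** Monotone convergence: for nonnegative terms the finite sums increase with the index set, so they
    converge to their supremum. *)
Lemma totally_cvg_ge0 (I : choiceType) (f : I -> R) (M : R) :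
  (forall i, 0 <= f i) -> (forall A : {fset I}, \sum_(i <- A) f i <= M) ->
  exists l : R, (summability.partial_sum f A @[A --> summability.totally] --> l)%classic.
Proof.
move=> f0 fM; pose S := [set \sum_(i <- A) f i | A in [set: {fset I}]]%classic.
have supS : has_sup S.
  split; first by exists (\sum_(i <- fset0) f i), fset0.
  by exists M => _ [A _ <-].
exists (sup S); apply/cvgrPdist_lt => e e0.
have [_ [A _ <-] ltA] := sup_adherent e0 supS.
exists A => // B /= AB; rewrite partial_sumE.
have leA : \sum_(i <- A) f i <= \sum_(i <- B) f i.
  by apply: ler_sum_sub => //; exact/fsubsetP.
have leB : \sum_(i <- B) f i <= sup S by apply: ub_le_sup; [case: supS|exists B].
by rewrite ger0_norm ?subr_ge0//; lra.
Qed.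

(** Writes [f] as [(f + |f|) - |f|], a difference of two nonnegative families whose finite sums are
    bounded by [M + M] and [M]. *)
Lemma totally_cvg_abs (I : choiceType) (f : I -> R) (M : R) :
  (forall A : {fset I}, \sum_(i <- A) `|f i| <= M) ->
  exists l : R, (summability.partial_sum f A @[A --> summability.totally] --> l)%classic.
Proof.
move=> fM.
have [A|l1 fl1] := @totally_cvg_ge0 I (fun i => `|f i|) M (fun=> normr_ge0 _).
  exact: fM.
have [i|A|l2 fl2] := @totally_cvg_ge0 I (fun i => f i + `|f i|) (M + M).
- by have := ler_norm (- f i); rewrite normrN; lra.
- rewrite big_split /= lerD ?fM// (le_trans _ (fM A))//.
  by apply: ler_sum => i _; exact: ler_norm.
exists (l2 - l1); rewrite (_ : summability.partial_sum f = fun A =>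
  summability.partial_sum (fun i => f i + `|f i|) A -
  summability.partial_sum (fun i => `|f i|) A); first exact: cvgB.
apply/funext => A; rewrite !partial_sumE -sumrB.
by apply: eq_bigr => i _; rewrite addrK.
Qed.

Lemma normc_ge_ReIm (z : R[i]) :
  [/\ `|complex.Re z| <= normc z, `|complex.Im z| <= normc z &
      normc z <= `|complex.Re z| + `|complex.Im z|].
Proof.
case: z => a b /=; split.
- by rewrite -sqrtr_sqr ler_wsqrtr// lerDl sqr_ge0.
- by rewrite -sqrtr_sqr ler_wsqrtr// lerDr sqr_ge0.
- rewrite -(@ger0_norm _ (`|a| + `|b|)) ?addr_ge0// -sqrtr_sqr ler_wsqrtr//.
  by rewrite sqrrD !real_normK ?num_real// addrAC lerDl mulrn_wge0 ?mulr_ge0.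
Qed.

Lemma Re_sum (I : Type) (s : seq I) (f : I -> R[i]) :
  complex.Re (\sum_(i <- s) f i) = \sum_(i <- s) complex.Re (f i).
Proof. by elim/big_rec2: _ => //= i _ z _ <-; case: (f i); case: z. Qed.

Lemma Im_sum (I : Type) (s : seq I) (f : I -> R[i]) :
  complex.Im (\sum_(i <- s) f i) = \sum_(i <- s) complex.Im (f i).
Proof. by elim/big_rec2: _ => //= i _ z _ <-; case: (f i); case: z. Qed.

(** A relation rather than a value: it records convergence together with the limit, so it can be
    combined linearly, whereas the value [summability.sum] alone does not assert that a limit
    exists. *)
Definition sums_to (I : choiceType) (f : I -> C) (l : C) : Prop :=
  (@summability.partial_sum I C f A @[A --> summability.totally] --> l)%classic.

Lemma sums_to_unique (I : choiceType) (f : I -> C) (l m : C) :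
  sums_to f l -> sums_to f m -> l = m.
Proof. by move=> fl fm; rewrite -(norm_cvg_lim fl) -(norm_cvg_lim fm). Qed.

Lemma sums_toZ (I : choiceType) (f : I -> C) (c l : C) :
  sums_to f l -> sums_to (fun i => c * f i) (c * l).
Proof.
move=> fl; rewrite /sums_to (_ : summability.partial_sum _ = fun A =>
  c * @summability.partial_sum I C f A); first exact: cvgMl_tmp.
by apply/funext => A; rewrite !partial_sumE mulr_sumr.
Qed.

Lemma sums_toB (I : choiceType) (f g : I -> C) (l m : C) :
  sums_to f l -> sums_to g m -> sums_to (fun i => f i - g i) (l - m).
Proof.
move=> fl gm; rewrite /sums_to (_ : summability.partial_sum _ = fun A =>
  @summability.partial_sum I C f A - @summability.partial_sum I C g A).
  exact: (@cvgB C C _ _ _ _ _ _ _ fl gm).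
by apply/funext => A; rewrite !partial_sumE -sumrB.
Qed.

(** The modulus dominates the real and imaginary parts, so both converge absolutely; their limits
    are then reassembled into a complex limit. *)
Lemma totally_cvg_normc (I : choiceType) (f : I -> R[i]) (M : R) :
  (forall A : {fset I}, \sum_(i <- A) normc (f i) <= M) ->
  exists l : C, sums_to f l.
Proof.
move=> fM.
have [A|a fa] := @totally_cvg_abs I (fun i => complex.Re (f i)) M.
  by apply: le_trans (fM A); apply: ler_sum => i _; case: (normc_ge_ReIm (f i)).
have [A|b fb] := @totally_cvg_abs I (fun i => complex.Im (f i)) M.
  by apply: le_trans (fM A); apply: ler_sum => i _; case: (normc_ge_ReIm (f i)).
exists (a +i* b); apply/(@cvgrPdist_lt C C) => e e0.
(* The radius [e] lives in [R[i]], but being positive it is real, so half of its real part can serve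
   for each component. *)
have eE : e = (complex.Re e)%:C by rewrite RRe_real// gtr0_real.
have e2 : 0 < complex.Re e / 2 by rewrite divr_gt0// -ltcR -eE.
have na := (cvgrPdist_lt _ _).1 fa _ e2.
have nb := (cvgrPdist_lt _ _).1 fb _ e2.
near=> A; rewrite eE.
change ((normc (a +i* b - summability.partial_sum f A))%:C < (complex.Re e)%:C).
rewrite ltcR; set z := (X in normc X); have [_ _ /le_lt_trans] := normc_ge_ReIm z; apply.
have -> : complex.Re z = a - summability.partial_sum (fun i => complex.Re (f i)) A.
  by rewrite /z !partial_sumE -Re_sum; case: (\sum_(i <- A) f i).
have -> : complex.Im z = b - summability.partial_sum (fun i => complex.Im (f i)) A.
  by rewrite /z !partial_sumE -Im_sum; case: (\sum_(i <- A) f i).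
rewrite (splitr (complex.Re e)); apply: ltrD.
  by near: A; exact: na.
by near: A; exact: nb.
Unshelve. all: by end_near. Qed.

Lemma sum_geom_le (r : R) n : 0 <= r < 1 -> \sum_(i < n) r ^+ i <= (1 - r)^-1.
Proof.
move=> /andP[r0 r1]; rewrite -[leRHS]mul1r ler_pdivlMr ?subr_gt0//.
have -> : (\sum_(i < n) r ^+ i) * (1 - r) = 1 - r ^+ n.
  by rewrite -[in RHS]opprB subrX1; ring.
by rewrite lerBlDr lerDl exprn_ge0.
Qed.

Lemma normc_ge0 (z : R[i]) : 0 <= normc z.
Proof. by case: z => a b; exact: sqrtr_ge0. Qed.

Lemma normcX (z : R[i]) n : normc (z ^+ n) = normc z ^+ n.
Proof. by elim: n => [|n IH]; rewrite ?expr0 ?normc1// !exprS normcM IH. Qed.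

Lemma normc_lt1 (z : R[i]) : `|z| < 1 -> normc z < 1.
Proof. by rewrite -ltcR. Qed.

(** With bounded coefficients the moduli are dominated by a product of two geometric series, so a
    limit exists, and [dsum] is then that limit. *)
Lemma dsum_geom_cvg (u : nat -> nat -> R[i]) (K : R) (x y : R[i]) :
  (forall n k, normc (u n k) <= K) -> normc x < 1 -> normc y < 1 ->
  sums_to (fun p => u p.1 p.2 * x ^+ p.1 * y ^+ p.2)
    (dsum (fun n k => u n k * x ^+ n * y ^+ k)).
Proof.
move=> uK x1 y1; rewrite /dsum /summability.sum.
set f := fun p : nat * nat => _.
have K0 : 0 <= K by apply: le_trans (uK 0%N 0%N); exact: normc_ge0.
suff [l fl] : exists l : C, sums_to f l.
  by rewrite (norm_cvg_lim fl).
apply: (@totally_cvg_normc _ f (K * ((1 - normc x)^-1 * (1 - normc y)^-1))) => A.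
(* Enclosing [A] in a square of side [N] lets the dominating sum factor into two one-variable
   geometric sums. *)
have [N NA] : exists N, forall p, p \in A -> (p.1 < N)%N && (p.2 < N)%N.
  exists (\max_(p <- A) maxn p.1 p.2).+1 => p pA; rewrite !ltnS -geq_max.
  exact: (@leq_bigmax_seq _ _ _ (fun p : nat * nat => maxn p.1 p.2)).
pose t := [seq (i, j) | i <- iota 0 N, j <- iota 0 N].
apply: (@le_trans _ _ (\sum_(p <- t) K * (normc x ^+ p.1 * normc y ^+ p.2))).
  apply: (@le_trans _ _ (\sum_(p <- A) K * (normc x ^+ p.1 * normc y ^+ p.2))).
    apply: ler_sum => p _; rewrite !normcM !normcX -mulrA ler_wpM2r//.
    by rewrite mulr_ge0// exprn_ge0// normc_ge0.
  apply: ler_sum_sub.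
  - exact: fset_uniq.
  - by rewrite allpairs_uniq ?iota_uniq// => -[? ?] [? ?].
  - move=> p /NA /andP[p1 p2]; apply/allpairsP; exists p.
    by rewrite !mem_iota !add0n p1 p2; split=> //; case: (p).
  - by move=> p; rewrite !mulr_ge0 ?exprn_ge0 ?normc_ge0.
rewrite -mulr_sumr ler_wpM2l// big_allpairs /=.
under eq_bigr do rewrite -mulr_sumr.
rewrite -mulr_suml -[N in iota 0 N]subn0 -/(index_iota 0 N) !big_mkord.
have geo (z : R[i]) : normc z < 1 -> \sum_(i < N) normc z ^+ i <= (1 - normc z)^-1.
  by move=> z1; apply: sum_geom_le; rewrite normc_ge0.
by apply: ler_pM; rewrite ?geo// sumr_ge0// => i _; rewrite exprn_ge0// normc_ge0.
Qed.

End Summation.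

(** * Bounds and shift identities for the q-shifted factorial *)

Section QShifted.
Variables (R : realType) (q : R[i]).
Hypothesis q1 : normc q < 1.

Lemma prod_geom_le (f : nat -> R) (K r : R) n : 0 <= r < 1 -> 0 <= K ->
  (forall j, 0 <= f j <= 1 + K * r ^+ j) ->
  \prod_(j < n) f j <= expR (K / (1 - r)).
Proof.
move=> r01 K0 fK; apply: (@le_trans _ _ (\prod_(j < n) expR (K * r ^+ j))).
  apply: ler_prod => j _; have /andP[-> /le_trans fj] := fK j.
  by apply: fj; exact: expR_ge1Dx.
by rewrite -expR_sum ler_expR -mulr_sumr ler_wpM2l// sum_geom_le.
Qed.

Lemma normc_prod n (f : 'I_n -> R[i]) :
  normc (\prod_(j < n) f j) = \prod_(j < n) normc (f j).
Proof. by elim/big_rec2: _ => [|i _ z _ <-]; rewrite ?normc1 ?normcM. Qed.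

Lemma normcB1_le (z : R[i]) : normc (1 - z) <= 1 + normc z.
Proof. by rewrite -normc1 -(normcN z) le_normcD. Qed.

Lemma qfact_bounded (a : R[i]) : exists K : R, forall n, normc (qfact q a n) <= K.
Proof.
exists (expR (normc a / (1 - normc q))) => n; rewrite /qfact normc_prod.
apply: (@prod_geom_le (fun j => normc (1 - a * q ^+ j))).
- by rewrite normc_ge0.
- exact: normc_ge0.
- by move=> j; rewrite normc_ge0 -normcX -normcM normcB1_le.
Qed.

Lemma qdenom_neq0 (c : R[i]) j : q != 0 -> qdenom q c -> 1 - c * q ^+ j != 0.
Proof.
move=> q0 /(_ j); apply: contraNneq => /eqP; rewrite subr_eq0 => /eqP e.
by rewrite -[q ^- j]mul1r e mulfK ?expf_neq0.
Qed.

Lemma qfact_neq0 (c : R[i]) n : q != 0 -> qdenom q c -> qfact q c n != 0.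
Proof. by move=> q0 qc; apply/prodf_neq0 => j _; exact: qdenom_neq0. Qed.

Lemma normc_gt0 (z : R[i]) : z != 0 -> 0 < normc z.
Proof. by rewrite -normr_gt0 -ltcR. Qed.

(** The factors tend to 1, so all but finitely many have modulus at least 1/2; the others are
    nonzero and have a positive minimum. *)
Lemma qdenom_lbound (c : R[i]) : q != 0 -> qdenom q c ->
  exists2 m : R, 0 < m & forall j, m <= normc (1 - c * q ^+ j).
Proof.
move=> q0 qc.
have [N NP] : exists N, forall j, (N <= j)%N -> normc c * normc q ^+ j <= 2^-1.
  have : ((fun j => normc c * normc q ^+ j) @ \oo --> (normc c * 0))%classic.
    apply: cvgM; first exact: cvg_cst.
    by apply: cvg_expr; rewrite ger0_norm ?normc_ge0.
  rewrite mulr0 => /cvgrPdist_le/(_ (2^-1))[|N _ NP]; first by rewrite invr_gt0.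
  exists N => j /NP /=; rewrite sub0r normrN ger0_norm//.
  by rewrite mulr_ge0 ?exprn_ge0 ?normc_ge0.
have [m m0 mP] : exists2 m : R, 0 < m &
    forall j, (j < N)%N -> m <= normc (1 - c * q ^+ j).
  elim: N {NP} => [|N [m m0 mP]]; first by exists 1.
  exists (Num.min m (normc (1 - c * q ^+ N))) => [|j].
    by rewrite lt_min m0 normc_gt0// qdenom_neq0.
  by rewrite ltnS leq_eqVlt ge_min => /orP[/eqP->|/mP->//]; rewrite lexx orbT.
exists (Num.min m 2^-1) => [|j]; first by rewrite lt_min m0 invr_gt0 ltr0n.
case: (ltnP j N) => [/mP|/NP] jN; rewrite ge_min ?jN//.
(* Reverse triangle inequality; for [j >= N] the last modulus is at most 1/2. *)
have : normc 1 <= normc (1 - c * q ^+ j) + normc (c * q ^+ j).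
  by rewrite (le_trans _ (le_normcD _ _))// subrK.
rewrite normc1 normcM normcX => le1; apply/orP; right; lra.
Qed.

Lemma qfactV_bounded (c : R[i]) : q != 0 -> qdenom q c ->
  exists K : R, forall n, normc (qfact q c n)^-1 <= K.
Proof.
move=> q0 qc; have [m m0 mP] := qdenom_lbound q0 qc.
(* Each inverse factor exceeds 1 in modulus by at most [(|c| / m) |q|^j], which fixes the constant
   for [prod_geom_le]. *)
exists (expR (normc c / m / (1 - normc q))) => n.
rewrite /qfact -prodfV normc_prod.
apply: (@prod_geom_le (fun j => normc (1 - c * q ^+ j)^-1)).
- by rewrite normc_ge0.
- by rewrite divr_ge0 ?normc_ge0 ?ltW.
move=> j; rewrite normc_ge0 /=.
(* 1 / (1 - z) = 1 + z / (1 - z), where |1 - z| >= m *)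
have nz := qdenom_neq0 j q0 qc.
have -> : (1 - c * q ^+ j)^-1 = 1 + (c * q ^+ j) / (1 - c * q ^+ j).
  by field.
rewrite (le_trans (le_normcD _ _))// normc1 lerD2l !normcM normcV normcX mulrAC.
rewrite ler_wpM2r ?exprn_ge0 ?normc_ge0// ler_wpM2l ?normc_ge0//.
by rewrite lef_pV2 ?posrE// normc_gt0.
Qed.

(** Makes the factors [(q;q)_n] and [(q;q)_k] of the denominators invertible: an equality [q = q^-m]
    would force [|q| >= 1]. *)
Lemma qdenom_q : q != 0 -> qdenom q q.
Proof.
move=> q0 m; apply: contraTneq q1 => qE; rewrite -leNgt qE normcV normcX.
by rewrite invf_ge1 ?exprn_gt0 ?normc_gt0// exprn_ile1 ?normc_ge0// ltW.
Qed.

Lemma qfactS (a : R[i]) n : qfact q a n.+1 = qfact q a n * (1 - a * q ^+ n).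
Proof. by rewrite /qfact big_ord_recr. Qed.

(** Both sides are [(a;q)_(n+1)], with the last factor split off on the left and the first on the
    right. *)
Lemma qfact_shift (a : R[i]) n :
  (1 - a * q ^+ n) * qfact q a n = (1 - a) * qfact q (a * q) n.
Proof.
rewrite mulrC -qfactS /qfact big_ord_recl expr0 mulr1; congr (_ * _).
by apply: eq_bigr => j _; rewrite /= exprS mulrA.
Qed.

(** The condition [c * q != q] excludes [c = 1]; any other bad value [c = q^-(m+1)] would give
    [c * q = q^-m]. *)
Lemma qdenom_pred (c : R[i]) : q != 0 -> qdenom q (c * q) -> c * q != q -> qdenom q c.
Proof.
move=> q0 qc cq [|m]; first by apply: contraNneq cq => ->; rewrite expr0 invr1 mul1r.
apply: contraNneq (qc m) => ->; by rewrite exprSr invfM mulfVK.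
Qed.

Lemma qfactV_shift (c : R[i]) n : q != 0 -> qdenom q (c * q) -> c * q != q ->
  (1 - c * q ^+ n) / qfact q (c * q) n = (1 - c) / qfact q c n.
Proof.
move=> q0 qc cq; have nz := qfact_neq0 n q0 qc.
have nz' := qfact_neq0 n q0 (qdenom_pred q0 qc cq).
by apply/eqP; rewrite eqr_div// qfact_shift.
Qed.

End QShifted.

(** * Termwise action of the operators and reduction to coefficient identities *)

Section Operators.
Variables (R : realType) (q lq : R[i]).
Hypotheses (q0 : q != 0) (q1 : normc q < 1).

Lemma iter_dil a b (f : R[i] -> R[i] -> R[i]) (x y : R[i]) :
  iter a (dilx q) (iter b (dily q) f) x y = f (q ^+ a * x) (q ^+ b * y).
Proof.
elim: a x => [|a IH] x /=.
  rewrite expr0 mul1r; elim: b y => [|b IH] y /=; first by rewrite expr0 mul1r.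
  by rewrite /dily IH exprSr mulrA.
by rewrite /dilx IH exprSr mulrA.
Qed.

Definition bounded_fam (u : nat -> nat -> R[i]) : Prop :=
  exists K : R, forall n k, normc (u n k) <= K.

Lemma bounded_famM (u w : nat -> nat -> R[i]) :
  bounded_fam u -> bounded_fam w -> bounded_fam (fun n k => u n k * w n k).
Proof.
move=> [K uK] [L wL]; exists (K * L) => n k.
by rewrite normcM ler_pM ?normc_ge0.
Qed.

(** Dilation multiplies [x^n y^k] by [q^(a n + b k)], so after cancelling [1 - q] both sides are
    sums of the same family, and limits are unique. *)
Lemma qTheta_dsum (a b : nat) (z : R[i]) (u w : nat -> nat -> R[i]) (x y : R[i]) :
  bounded_fam u -> bounded_fam w ->
  normc x < 1 -> normc y < 1 ->
  (forall n k, (1 - qpow lq z * q ^+ (a * n + b * k)) * u n k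
     = (1 - qpow lq z) * w n k) ->
  qTheta q lq a b z (fun x y => dsum (fun n k => u n k * x ^+ n * y ^+ k)) x y
  = qnum q lq z * dsum (fun n k => w n k * x ^+ n * y ^+ k).
Proof.
move=> [K uK] [L wL] x1 y1 uw; rewrite /qTheta /qnum iter_dil mulrAC; congr (_ / _).
(* Since [|q| < 1], dilated points stay in the unit disc and the series converges there too. *)
have dil1 m (t : R[i]) : normc t < 1 -> normc (q ^+ m * t) < 1.
  move=> t1; rewrite normcM normcX (le_lt_trans _ t1)// ler_piMl ?normc_ge0//.
  by rewrite exprn_ile1 ?normc_ge0// ltW.
set x' := q ^+ a * x; set y' := q ^+ b * y.
have cu := dsum_geom_cvg uK x1 y1.
have cu' := dsum_geom_cvg uK (dil1 a x x1) (dil1 b y y1).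
have cw := dsum_geom_cvg wL x1 y1.
have cl := sums_toB cu (sums_toZ (c := qpow lq z) cu').
have cr := sums_toZ (c := 1 - qpow lq z) cw.
apply: (sums_to_unique cl); congr (sums_to _ _): cr.
apply/funext => -[n k] /=; rewrite !mulrA -uw !exprMn -!exprM exprD; ring.
Qed.

Lemma bounded_qfact (a : R[i]) (s : nat -> nat -> nat) :
  bounded_fam (fun n k => qfact q a (s n k)).
Proof. by have [K aK] := qfact_bounded q1 a; exists K. Qed.

Lemma bounded_qfactV (c : R[i]) (s : nat -> nat -> nat) :
  qdenom q c -> bounded_fam (fun n k => (qfact q c (s n k))^-1).
Proof. by move=> qc; have [K cK] := qfactV_bounded q1 q0 qc; exists K. Qed.

Lemma bounded_denom (c : R[i]) : qdenom q c ->
  bounded_fam (fun n k => (qfact q c (n + k)%N * qfact q q n * qfact q q k)^-1).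
Proof.
move=> qc; have qq := qdenom_q q1 q0.
have [K uK] := bounded_famM (bounded_famM (bounded_qfactV (fun n k => n + k)%N qc)
  (bounded_qfactV (fun n _ => n) qq)) (bounded_qfactV (fun _ k => k) qq).
by exists K => n k; rewrite !invfM.
Qed.

Lemma cexpD (z w : R[i]) : cexp (z + w) = cexp z * cexp w.
Proof.
case: z w => [a b] [c d] /=; rewrite expRD cosD sinD.
by apply/eqP; rewrite eq_complex /=; apply/andP; split; apply/eqP; ring.
Qed.

(** The fact that [lq] is a logarithm of [q] enters here: it turns a unit shift of the exponent into
    a multiplication by [q]. *)
Lemma qpowS (z : R[i]) : cexp lq = q -> qpow lq (z + 1) = qpow lq z * q.
Proof. by rewrite /qpow mulrDl mul1r cexpD => ->. Qed.

Lemma bounded_Phi1 (a b c : R[i]) : qdenom q c -> bounded_fam (fun n k =>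
  qfact q a (n + k)%N * qfact q b n
    / (qfact q c (n + k)%N * qfact q q n * qfact q q k)).
Proof.
move=> qc; apply: bounded_famM (bounded_denom qc).
by apply: bounded_famM; exact: bounded_qfact.
Qed.

Lemma bounded_Phi2 (a b c : R[i]) : qdenom q c -> bounded_fam (fun n k =>
  qfact q a n * qfact q b k
    / (qfact q c (n + k)%N * qfact q q n * qfact q q k)).
Proof.
move=> qc; apply: bounded_famM (bounded_denom qc).
by apply: bounded_famM; exact: bounded_qfact.
Qed.

Lemma bounded_Phi3 (a c : R[i]) : qdenom q c -> bounded_fam (fun n k =>
  qfact q a n / (qfact q c (n + k)%N * qfact q q n * qfact q q k)).
Proof. by move=> qc; apply: bounded_famM (bounded_denom qc); exact: bounded_qfact. Qed.

(** Serves the identities that lower the denominator parameter, where only one factor of the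
    denominator changes. *)
Lemma eq_frac_denom (A B c d s t P : R[i]) : A / c = B / d ->
  A * (P / (c * s * t)) = B * (P / (d * s * t)).
Proof. by move=> e; rewrite !invfM -!mulrA mulrCA [A * _]mulrA e -!mulrA mulrCA. Qed.

End Operators.

Theorem theorem2p7 (R : realType) (q lq : R[i])
    (hq : 0 < `|q| < 1) (hlq : cexp lq = q)
    (alpha beta gamma x y : R[i]) (hx : `|x| < 1) (hy : `|y| < 1) :
  (qdenom q (qpow lq gamma) ->
     qTheta q lq 1 1 alpha
         (Phi1 q (qpow lq alpha) (qpow lq beta) (qpow lq gamma)) x y
       = qnum q lq alpha
         * Phi1 q (qpow lq (alpha + 1)) (qpow lq beta) (qpow lq gamma) x y
  /\ qTheta q lq 1 0 beta
         (Phi1 q (qpow lq alpha) (qpow lq beta) (qpow lq gamma)) x y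
       = qnum q lq beta
         * Phi1 q (qpow lq alpha) (qpow lq (beta + 1)) (qpow lq gamma) x y
  /\ (qpow lq gamma != q ->
      qTheta q lq 1 1 (gamma - 1)
         (Phi1 q (qpow lq alpha) (qpow lq beta) (qpow lq gamma)) x y
       = qnum q lq (gamma - 1)
         * Phi1 q (qpow lq alpha) (qpow lq beta) (qpow lq (gamma - 1)) x y)
  /\ qTheta q lq 1 0 alpha
         (Phi2 q (qpow lq alpha) (qpow lq beta) (qpow lq gamma)) x y
       = qnum q lq alpha
         * Phi2 q (qpow lq (alpha + 1)) (qpow lq beta) (qpow lq gamma) x y
  /\ qTheta q lq 0 1 beta
         (Phi2 q (qpow lq alpha) (qpow lq beta) (qpow lq gamma)) x y
       = qnum q lq beta
         * Phi2 q (qpow lq alpha) (qpow lq (beta + 1)) (qpow lq gamma) x y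
  /\ (qpow lq gamma != q ->
      qTheta q lq 1 1 (gamma - 1)
         (Phi2 q (qpow lq alpha) (qpow lq beta) (qpow lq gamma)) x y
       = qnum q lq (gamma - 1)
         * Phi2 q (qpow lq alpha) (qpow lq beta) (qpow lq (gamma - 1)) x y))
  /\
  (qdenom q (qpow lq beta) ->
     qTheta q lq 1 0 alpha (Phi3 q (qpow lq alpha) (qpow lq beta)) x y
       = qnum q lq alpha
         * Phi3 q (qpow lq (alpha + 1)) (qpow lq beta) x y
  /\ (qpow lq beta != q ->
      qTheta q lq 1 1 (beta - 1) (Phi3 q (qpow lq alpha) (qpow lq beta)) x y
       = qnum q lq (beta - 1)
         * Phi3 q (qpow lq alpha) (qpow lq (beta - 1)) x y)).

Proof.
have [q0 q1] : q != 0 /\ normc q < 1.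
  by move: hq; rewrite normr_gt0 => /andP[? /normc_lt1].
have [x1 y1] := (normc_lt1 hx, normc_lt1 hy).
(* Puts the denominator parameter in the form [c * q] with [c = q^(z-1)], as the shift lemmas
   require. *)
have predE z : qpow lq z = qpow lq (z - 1) * q by rewrite -(qpowS _ hlq) subrK.
have pred_denom z : qdenom q (qpow lq z) -> qpow lq z != q ->
    qdenom q (qpow lq (z - 1)).
  by rewrite predE; exact: qdenom_pred.
have pred_shift z n : qdenom q (qpow lq z) -> qpow lq z != q ->
    (1 - qpow lq (z - 1) * q ^+ n) / qfact q (qpow lq z) n
      = (1 - qpow lq (z - 1)) / qfact q (qpow lq (z - 1)) n.
  by rewrite predE; exact: qfactV_shift.
split=> [qc|qb].
- have B1 a b := bounded_Phi1 q0 q1 a b qc.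
  have B2 a b := bounded_Phi2 q0 q1 a b qc.
  split; [|split; [|split; [|split; [|split]]]].
  + apply: (qTheta_dsum q1 (B1 _ _) (B1 _ _) x1 y1) => n k.
    by rewrite !mul1n (qpowS _ hlq) !mulrA qfact_shift.
  + apply: (qTheta_dsum q1 (B1 _ _) (B1 _ _) x1 y1) => n k.
    (* The alpha factor is moved behind the beta factor, which then meets the multiplier it
       absorbs. *)
    rewrite mul1n mul0n addn0 (qpowS _ hlq) ![qfact q (qpow lq alpha) _ * _]mulrC.
    by rewrite !mulrA qfact_shift.
  + move=> cq.
    apply: (qTheta_dsum q1 (B1 _ _) (bounded_Phi1 q0 q1 _ _ (pred_denom _ qc cq)) x1 y1).
    by move=> n k; rewrite !mul1n; apply: eq_frac_denom; exact: pred_shift.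
  + apply: (qTheta_dsum q1 (B2 _ _) (B2 _ _) x1 y1) => n k.
    by rewrite mul1n mul0n addn0 (qpowS _ hlq) !mulrA qfact_shift.
  + apply: (qTheta_dsum q1 (B2 _ _) (B2 _ _) x1 y1) => n k.
    rewrite mul1n mul0n add0n (qpowS _ hlq) ![qfact q (qpow lq alpha) _ * _]mulrC.
    by rewrite !mulrA qfact_shift.
  + move=> cq.
    apply: (qTheta_dsum q1 (B2 _ _) (bounded_Phi2 q0 q1 _ _ (pred_denom _ qc cq)) x1 y1).
    by move=> n k; rewrite !mul1n; apply: eq_frac_denom; exact: pred_shift.
- have B3 a := bounded_Phi3 q0 q1 a qb.
  split=> [|bq].
  + apply: (qTheta_dsum q1 (B3 _) (B3 _) x1 y1) => n k.
    by rewrite mul1n mul0n addn0 (qpowS _ hlq) !mulrA qfact_shift.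
  + apply: (qTheta_dsum q1 (B3 _) (bounded_Phi3 q0 q1 _ (pred_denom _ qb bq)) x1 y1).
    by move=> n k; rewrite !mul1n; apply: eq_frac_denom; exact: pred_shift.
Qed.
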